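(* Let $\lambda = (\lambda_1 \geq \lambda_2 \geq \dots \geq \lambda_k)$ be a partition. Then $$\sum_{\mu \leq \lambda} q^{|\mu|} = \det\left( q^{\binom{j-i+1}{2}} \begin{bmatrix} \lambda_j + 1 \\ j-i+1 \end{bmatrix}_q \right)_{i,j=1}^{k},$$ where the sum runs over all $\mu$ contained in $\lambda$, and $|\mu| = \mu_1 + \dots + \mu_k$ is the size of $\mu$.
   Context: A partition $\lambda = (\lambda_1 \geq \dots \geq \lambda_k > 0)$ is a finite weakly decreasing sequence of positive integers. One says $\mu$ is contained in $\lambda = (\lambda_1 \geq \dots \geq \lambda_k)$, written $\mu \leq \lambda$, if $\mu = (\mu_1 \geq \mu_2 \geq \dots \geq \mu_k \geq 0)$ is a weakly decreasing sequence of $k$ non-negative integers with $\mu_i \leq \lambda_i$ for $1 \leq i \leq k$. Here $q$ is an indeterminate and $\begin{bmatrix} a \\ b \end{bmatrix}_q$ is the usual Gaussian ($q$-)binomial coefficient, equal to $0$ when $b<0$ or $b>a$ (so matrix entries with $j-i+1<0$ are $0$). *)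

(* Defs.v *)
From HB Require Import structures.
From mathcomp Require Import all_boot all_order all_algebra.
From mathcomp Require Import zify ring.

Set Implicit Arguments.
Unset Strict Implicit.
Unset Printing Implicit Defensive.

Import GRing.Theory Num.Theory.
Local Open Scope ring_scope.

Definition is_partition (lam : seq nat) : bool :=
  sorted geq lam && all (leq 1) lam.

(* [all2] also forces [mu] and [lam] to have the same length; unlike the parts
   of [lam], entries of [mu] may be 0. *)
Definition contained (mu lam : seq nat) : bool :=
  sorted geq mu && all2 leq mu lam.

Definition max_part (lam : seq nat) : nat := \max_(l <- lam) l.

(* The tuples over 'I_(max_part lam).+1 used to index sums over the contained
   sequences miss none of them. *)
Lemma contained_tupleP (k : nat) (lam : k.-tuple nat) (mu : seq nat) :
  contained mu lam ->
  exists t : k.-tuple 'I_(max_part lam).+1, map val t = mu.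
Proof.
case/andP=> _; rewrite all2E => /andP[/eqP szmu /allP le_mu].
have szk : size mu == k by rewrite szmu size_tuple.
exists (map_tuple inord (Tuple szk)); rewrite /= -map_comp.
rewrite -[RHS]map_id; apply/eq_in_map => x x_mu /=; rewrite inordK // ltnS.
have ix : (index x mu < size mu)%N by rewrite index_mem.
have /le_mu : (x, nth 0 lam (index x mu)) \in zip mu lam.
  rewrite -{1}(nth_index 0 x_mu) -nth_zip //.
  by apply: mem_nth; rewrite size_zip -szmu minnn.
move=> /leq_trans; apply; apply: leq_bigmax_seq => //.
by rewrite mem_nth // -szmu.
Qed.

(* The indeterminate q is 'X : {poly int}. *)
Definition qnat (n : nat) : {poly int} := \sum_(i < n) 'X^i.

Definition qfact (n : nat) : {poly int} := \prod_(i < n) qnat i.+1.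

(* [%/] is Euclidean division in Z[q]; the divisor is monic and the division is
   exact, see [qbinomE]. *)
Definition qbinom (a : nat) (b : int) : {poly int} :=
  if (0 <= b) && (b <= a%:Z) then
    qfact a %/ (qfact `|b|%N * qfact (a - `|b|)%N)
  else 0.

(* The binomial coefficient "m choose 2" at an arbitrary integer m, where
   m * (m - 1) / 2 is always a nonnegative integer. *)
Definition binz2 (m : int) : nat := `|(m * (m - 1) %/ 2)%Z|%N.

Lemma binz2_nat (n : nat) : binz2 n%:Z = 'C(n, 2).
Proof.
rewrite /binz2 bin2; case: n => [|n] //.
have -> : n.+1%:Z - 1 = n%:Z by lia.
by rewrite -PoszM divz_nat absz_nat -divn2.
Qed.

Lemma qnatD (m n : nat) : qnat (m + n) = qnat m + 'X^m * qnat n.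
Proof.
rewrite /qnat big_split_ord /=; congr (_ + _); rewrite mulr_sumr.
by apply: eq_bigr => i _; rewrite exprD.
Qed.

Lemma qfactS (n : nat) : qfact n.+1 = qfact n * qnat n.+1.
Proof. by rewrite /qfact big_ord_recr. Qed.

Lemma monic_qnatS (n : nat) : qnat n.+1 \is monic.
Proof.
have -> : qnat n.+1 = \poly_(i < n.+1) 1.
  by rewrite poly_def; apply: eq_bigr => i _; rewrite scale1r.
by rewrite monicE lead_coef_poly ?oner_eq0.
Qed.

Lemma monic_qfact (n : nat) : qfact n \is monic.
Proof. by apply: monic_prod => i _; apply: monic_qnatS. Qed.

Lemma qfactD (m n : nat) : exists c : {poly int}, qfact (m + n) = c * (qfact m * qfact n).
Proof.
have [s] := ubnP (m + n)%N; elim: s m n => // s IH [|m] [|n] lt_s.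
- by exists 1; rewrite /qfact !big_ord0 !mul1r.
- by exists 1; rewrite /qfact big_ord0 !mul1r.
- by exists 1; rewrite /qfact addn0 big_ord0 mulr1 mul1r.
have [|c Ec] := IH m n.+1; first by lia.
have [|d Ed] := IH m.+1 n; first by lia.
exists (c + 'X^(m.+1) * d).
rewrite addSn qfactS -addSn qnatD mulrDr {1}Ec.
have -> : (m + n.+1 = m.+1 + n)%N by lia.
by rewrite Ed !qfactS; ring.
Qed.

Lemma qbinomE (a b : nat) : (b <= a)%N ->
  qbinom a b%:Z * (qfact b * qfact (a - b)) = qfact a.
Proof.
move=> le_ba; rewrite /qbinom lez_nat le_ba /=.
have [c] := qfactD b (a - b); rewrite subnKC // => ->.
by rewrite Pdiv.IdomainMonic.mulpK // monicMl monic_qfact.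
Qed.

(* Main.v *)
(** For a fixed [n], let [E_m(t)] be the elementary symmetric polynomial of
    degree [m] in [q^t, ..., q^n], and let [F_k(t)] be the sum of [q^|mu|] over
    the [mu] contained in [(lam_1, ..., lam_k)] whose parts are all at least [t].
    Then [F_k(t) = F_k(t+1) + q^t F_(k-1)(t)] and
    [E_m(t) = E_m(t+1) + q^t E_(m-1)(t+1)], so that the alternating sum
    [\sum_m (-1)^m E_m(t) F_(k-m)(t)] does not depend on [t <= n + 1] when
    [n = lam_k]; it vanishes at [t = n + 1], hence at [t = 0].  These relations
    at [t = 0] say that the signed [F_k(0)] form the first row of the inverse of
    a unitriangular matrix, and Cramer's rule reads [F_k(0)] off as a minor of
    that matrix, which is the determinant of the theorem. *)
Require Import Defs.
From mathcomp Require Import all_boot all_order all_algebra.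
From mathcomp Require Import zify ring.

Import GRing.Theory Num.Theory.
Local Open Scope ring_scope.

Lemma qfact0 : qfact 0 = 1.
Proof. by rewrite /qfact big_ord0. Qed.

Lemma qbinom0 (a : nat) : qbinom a 0%N%:Z = 1.
Proof.
have := @qbinomE a 0 isT; rewrite subn0 qfact0 mul1r => E.
by apply: (mulIf (monic_neq0 (monic_qfact a))); rewrite E mul1r.
Qed.

Lemma qbinomnn (a : nat) : qbinom a a%:Z = 1.
Proof.
have := @qbinomE a a (leqnn a); rewrite subnn qfact0 mulr1 => E.
by apply: (mulIf (monic_neq0 (monic_qfact a))); rewrite E mul1r.
Qed.

Lemma qbinom_small (a b : nat) : (a < b)%N -> qbinom a b%:Z = 0.
Proof. by move=> lt_ab; rewrite /qbinom lez_nat (leqNgt b) lt_ab. Qed.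

Lemma qbinomS (a b : nat) :
  qbinom a.+1 b.+1%:Z = 'X^(b.+1) * qbinom a b.+1%:Z + qbinom a b%:Z.
Proof.
case: (ltngtP a b) => [lt_ab|lt_ba|->].
- by rewrite !qbinom_small ?mulr0 ?addr0 // ltnS ltnW.
- have E1 := @qbinomE a.+1 b.+1 (ltnW lt_ba).
  have E2 := @qbinomE a b.+1 lt_ba; have E3 := @qbinomE a b (ltnW lt_ba).
  have Ds : (a - b = (a - b.+1).+1)%N by lia.
  apply: (mulIf (monic_neq0 (monic_qfact (a - b)))).
  apply: (mulIf (monic_neq0 (monic_qfact b.+1))).
  rewrite subSS in E1.
  transitivity (qfact a.+1); first by rewrite -E1; ring.
  (* Splitting [a + 1] as [(b + 1) + (a - b)] in the last factor yields the two terms of the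
     recurrence. *)
  have -> : qfact a.+1 = qfact a * qnat b.+1 + 'X^(b.+1) * (qfact a * qnat (a - b)).
    by rewrite qfactS (_ : a.+1 = (b.+1 + (a - b))%N) ?qnatD; [ring | lia].
  rewrite -{1}E3 -{1}E2 Ds !qfactS; ring.
- by rewrite !qbinomnn qbinom_small // mulr0 add0r.
Qed.

(* The elementary symmetric polynomial of degree [m] in
   [q^t, ..., q^(t + r - 1)]. *)
Definition qelem (r t m : nat) : {poly int} :=
  'X^(t * m + 'C(m, 2)) * qbinom r m%:Z.

Lemma qelem0 (r t : nat) : qelem r t 0 = 1.
Proof. by rewrite /qelem qbinom0 muln0 mulr1. Qed.

Lemma qelemS (r t m : nat) :
  qelem r.+1 t m.+1 = qelem r t.+1 m.+1 + 'X^t * qelem r t.+1 m.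
Proof.
rewrite /qelem qbinomS mulrDr !mulrA -!exprD binS bin1.
by congr ('X^_ * _ + 'X^_ * _); lia.
Qed.

(* The parts are listed in increasing order: [l] is the last part of the
   partition, and [c] that of the contained sequence. *)
Fixpoint contained_gf (s : seq nat) (t : nat) : {poly int} :=
  if s is l :: s' then \sum_(t <= c < l.+1) 'X^c * contained_gf s' c else 1.

Lemma contained_gf_recl (l : nat) (s : seq nat) (t : nat) : (t <= l)%N ->
  contained_gf (l :: s) t =
    contained_gf (l :: s) t.+1 + 'X^t * contained_gf s t.
Proof. by move=> le_tl; rewrite /= big_ltn // addrC. Qed.

(** The partial sums up to [k < N] differ by the single boundary term [(-1)^k x e'_k d_(k+1)]; the
    last summand absorbs it, and [d N = d' N] closes the sum. *)
Lemma alt_sum_telescope (R : comNzRingType) (x : R) (e e' d d' : nat -> R)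
    (N : nat) :
    e 0%N = e' 0%N -> (forall m, e m.+1 = e' m.+1 + x * e' m) ->
    (forall m, (m < N)%N -> d m = d' m + x * d m.+1) -> d N = d' N ->
  \sum_(m < N.+1) (-1) ^+ m * e m * d m =
  \sum_(m < N.+1) (-1) ^+ m * e' m * d' m.
Proof.
move=> e0 eS dS dN.
have tele k : (k < N)%N ->
    \sum_(m < k.+1) (-1) ^+ m * e m * d m =
    \sum_(m < k.+1) (-1) ^+ m * e' m * d' m + (-1) ^+ k * (x * e' k * d k.+1).
  elim: k => [|k IH] lt_kN.
    by rewrite !big_ord1 /= e0 (dS 0%N lt_kN); ring.
  rewrite big_ord_recr [in RHS]big_ord_recr /= IH ?(ltnW lt_kN) //.
  by rewrite eS (dS k.+1 lt_kN) exprS; ring.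
case: N => [|N] in dS dN tele *; first by rewrite !big_ord1 e0 dN.
rewrite big_ord_recr [in RHS]big_ord_recr /= tele // eS dN exprS; ring.
Qed.

Lemma alt_sum_qelem_contained_gf (n : nat) (s : seq nat) (r t : nat) :
  sorted leq (n :: s) -> (t + r = n.+1)%N ->
  \sum_(m < (size s).+2)
     (-1) ^+ m * qelem r t m * contained_gf (drop m (n :: s)) t = 0.
Proof.
move=> s_sorted; elim: r t => [|r IH] t tr.
  (* Here [t = n + 1]: the first summand is an empty sum over parts in [[t, n]], and the others
     contain an elementary symmetric polynomial of positive degree in no variables. *)
  rewrite big_ord_recl qelem0 drop0 /= big_geq ?mulr0 ?add0r; last by lia.
  apply: big1 => i _; rewrite /= /qelem qbinom_small // mulr0.
  by rewrite mulr0 mul0r.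
rewrite -[RHS](IH t.+1); last by lia.
apply: (@alt_sum_telescope _ 'X^t (qelem r.+1 t) (qelem r t.+1)
          (fun m => contained_gf (drop m (n :: s)) t)
          (fun m => contained_gf (drop m (n :: s)) t.+1)).
- by rewrite !qelem0.
- by move=> m; apply: qelemS.
- move=> m lt_m; rewrite (drop_nth 0%N) //; apply: contained_gf_recl.
  have le_n : (n <= nth 0 (n :: s) m)%N.
    by apply: (sorted_leq_nth leq_trans leqnn 0%N s_sorted 0%N m).
  by lia.
- by rewrite /= drop_size.
Qed.

Lemma contained_gfE (N : nat) (s : seq nat) (t : nat) :
  all (fun l => l <= N)%N s ->
  contained_gf s t =
    \sum_(mu : (size s).-tuple 'I_N.+1 |
           path leq t (map val mu) && all2 leq (map val mu) s)
       'X^(sumn (map val mu)).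
Proof.
elim: s t => [|l s IH] t /=.
  move=> _; rewrite (big_pred1 [tuple]) //= => mu; rewrite tuple0 /=.
  by rewrite eqxx.
case/andP=> le_lN le_sN.
rewrite (reindex (fun p : 'I_N.+1 * (size s).-tuple 'I_N.+1 =>
                    [tuple of p.1 :: p.2])) /=; last first.
  exists (fun mu : (size s).+1.-tuple 'I_N.+1 => (thead mu, [tuple of behead mu])).
    by move=> [c mu] _ /=; rewrite theadE; congr pair; apply: val_inj.
  by move=> mu _; rewrite /= -tuple_eta.
transitivity (\sum_(c < N.+1 | (t <= c)%N && (c <= l)%N)
                'X^c * contained_gf s c).
  rewrite big_geq_mkord (big_ord_widen_cond N.+1 (leq t)
            (fun c => 'X^c * contained_gf s c)) //.
under [LHS]eq_bigr => c _ do rewrite IH // mulr_sumr.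
rewrite pair_big_dep /=; apply: eq_big => [[c mu]|[c mu] _] /=.
  by rewrite !andbA; congr (_ && _); rewrite -!andbA; congr (_ && _); rewrite andbC.
by rewrite exprD.
Qed.

(** Reversal makes the sequences increasing, and then the lower bound 0 is vacuous. *)
Lemma contained_rev (mu lam : seq nat) :
  contained mu lam = path leq 0 (rev mu) && all2 leq (rev mu) (rev lam).
Proof.
rewrite /contained path_sortedE; last exact: leq_trans.
rewrite rev_sorted !all2E !size_rev.
have -> : all (leq 0) (rev mu) by apply/allP.
by case: eqP => //= eq_sz; rewrite -rev_zip // all_rev.
Qed.

Lemma sum_contained (N k : nat) (lam : k.-tuple nat) :
    all (fun l => l <= N)%N lam ->
  \sum_(mu : k.-tuple 'I_N.+1 | contained (map val mu) lam)
     'X^(sumn (map val mu)) = contained_gf (rev lam) 0.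
Proof.
move=> le_lamN; rewrite (@contained_gfE N) ?all_rev //.
rewrite size_rev size_tuple.
rewrite (reindex_inj (h := fun mu : k.-tuple _ => [tuple of rev mu])) /=.
  apply: eq_big => mu; first by rewrite contained_rev map_rev revK.
  by rewrite map_rev sumn_rev.
by move=> mu mu' /(congr1 val) /= /(can_inj revK) /val_inj.
Qed.

(* [c j m] is the entry of column [j] on the [m]-th diagonal, counted from the
   subdiagonal; [f j] is, up to sign, the [j]-th entry of the first row of the
   inverse of the unitriangular matrix [U] whose last minor is the determinant. *)
Lemma det_hessenberg (R : comNzRingType) (n : nat) (c : nat -> nat -> R)
    (f : nat -> R) :
    (forall j, c j 0%N = 1) -> f 0%N = 1 ->
    (forall j, (j < n)%N ->
       \sum_(m < j.+2) (-1) ^+ m * c j m * f (j.+1 - m)%N = 0) ->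
  \det (\matrix_(i < n, j < n)
          (if (i <= j.+1)%N then c j (j.+1 - i)%N else 0)) = f n.
Proof.
move=> c0 f0 fS.
(* Deleting column 0, which is [(1, 0, ..., 0)], and the last row of [U] leaves the matrix of the
   statement. *)
pose U : 'M[R]_n.+1 := \matrix_(i, j)
  if (i <= j)%N then (if val j is j'.+1 then c j' (j - i)%N else 1) else 0.
pose v : 'rV[R]_n.+1 := \row_i ((-1) ^+ i * f i).
have detU : \det U = 1.
  rewrite -det_tr det_trig ?big1 // => [i _|].
    by rewrite !mxE leqnn; case: (val i) => // i'; rewrite subnn.
  by apply/is_trig_mxP => i j lt_ij; rewrite !mxE leqNgt lt_ij.
have vU : v *m U = delta_mx 0 0.
  apply/rowP => j; rewrite !mxE /=.
  rewrite (eq_bigr (fun i : 'I_n.+1 => if (i <= j)%N then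
      (-1) ^+ i * f i * (if val j is j'.+1 then c j' (j - i)%N else 1) else 0));
    last by move=> i _; rewrite !mxE; case: ifP => // _; rewrite mulr0.
  rewrite -big_mkcond /=.
  rewrite -(big_ord_widen_cond n.+1 xpredT (fun i => (-1) ^+ i * f i *
             (if val j is j'.+1 then c j' (j - i)%N else 1)) (ltn_ord j)) /=.
  case: j => [[|j] lt_jn] /=.
    by rewrite big_ord1 expr0 f0 !mulr1.
  transitivity ((-1) ^+ j.+1 *
      \sum_(m < j.+2) (-1) ^+ m * c j m * f (j.+1 - m)%N); last first.
    by rewrite fS // mulr0.
  rewrite (reindex_inj rev_ord_inj) /= mulr_sumr; apply: eq_bigr => m _.
  have le_m : (m <= j.+1)%N by rewrite -ltnS.
  rewrite subSS subKn // !mulrA -signr_odd oddB // signr_addb !signr_odd.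
  by rewrite -!mulrA; congr (_ * (_ * _)); rewrite mulrC.
(* As [\det U = 1], [v] is row 0 of [\adj U]; its last entry is the cofactor at row [n], column 0,
   whose sign [(-1)^n] is the one built into [v]. *)
have := congr1 (fun A : 'rV_n.+1 => A 0 ord_max) (congr1 (mulmx^~ (\adj U)) vU).
rewrite -mulmxA mul_mx_adj detU mulmx1 -rowE !mxE /cofactor /= addn0.
move/(can_inj (signrMK n)) => ->; congr (\det _).
apply/matrixP => i j; rewrite !mxE /=.
by rewrite /bump [(n <= i)%N]leqNgt ltn_ord /= add1n add0n.
Qed.

Theorem theorem1p2 (k : nat) (lam : k.-tuple nat) (Hlam : is_partition lam) :
  \sum_(mu : k.-tuple 'I_(max_part lam).+1 | contained (map val mu) lam)
     'X^(sumn (map val mu))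
  = \det (\matrix_(i < k, j < k)
       ('X^(binz2 (j%:Z - i%:Z + 1))
        * qbinom (tnth lam j).+1 (j%:Z - i%:Z + 1)))
  :> {poly int}.
Proof.
case/andP: Hlam => lam_sorted _.
rewrite sum_contained; last first.
  by apply/allP => l l_lam; apply: leq_bigmax_seq.
pose f j := contained_gf (rev (take j lam)) 0.
(* The variables are [1, q, ..., q^lam_j]; starting at exponent 0 leaves only the power ['C(m, 2)],
   as in the matrix entry with [m = j - i + 1]. *)
pose c j m := qelem (nth 0%N lam j).+1 0 m.
transitivity (f k); first by rewrite /f take_oversize ?size_tuple.
rewrite -(@det_hessenberg _ k c f) => [||//|j lt_jk].
- congr (\det _); apply/matrixP => i j; rewrite !mxE (tnth_nth 0%N).
  case: leqP => [le_ij|lt_ji].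
    have -> : j%:Z - i%:Z + 1 = (j.+1 - i)%N%:Z by lia.
    by rewrite binz2_nat /c /qelem mul0n add0n.
  by rewrite /qbinom (_ : (0 <= _) = false) ?mulr0 //; lia.
- by move=> j; apply: qelem0.
- by rewrite /f take0.
have lt_j : (j < size lam)%N by rewrite size_tuple.
have rev_take : rev (take j.+1 lam) = nth 0%N lam j :: rev (take j lam).
  by rewrite (take_nth 0%N) // rev_rcons.
have sz : size (rev (take j lam)) = j by rewrite size_rev size_take lt_j.
have := @alt_sum_qelem_contained_gf (nth 0%N lam j) (rev (take j lam))
  (nth 0%N lam j).+1 0.
rewrite -rev_take rev_sorted take_sorted // sz => /(_ isT erefl) E.
rewrite -[RHS]E; apply: eq_bigr => m _; congr (_ * _).
(* Dropping the [m] last of the first [j + 1] parts leaves the prefix of length [j + 1 - m]. *)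
rewrite /f drop_rev size_takel // take_takel //.
by rewrite leq_subr.
Qed.
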